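(* Let $G$ be a group and let $\{u_j(x_1,\dots,x_n)=1\}_{j\in J}$ be a system of equations with coefficients in $G$, i.e. $u_j\in G*F(x_1,\dots,x_n)$, where $F(x_1,\dots,x_n)$ is the free group with basis $x_1,\dots,x_n$. If the rank of the integer matrix whose $(j,i)$ entry is the exponent sum of $x_i$ in $u_j$ is less than the number $n$ of unknowns, then the number of solutions $(g_1,\dots,g_n)\in G^n$ of the system is divisible by the order of the centraliser in $G$ of the set of all coefficients of the system.
   Context: The coefficients of the system are the elements of $G$ occurring in the words $u_j$. The group $G$ need not be finite; divisibility is understood in the sense of cardinal arithmetic: any infinite cardinal is divisible by any smaller or equal nonzero cardinal, and zero is divisible by any cardinal. *)

(* Defs.v *)
From HB Require Import structures.
From mathcomp Require Import all_boot all_order all_algebra.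
From mathcomp Require Import boolp classical_sets functions cardinality.

Set Implicit Arguments.
Unset Strict Implicit.
Unset Printing Implicit Defensive.

Local Open Scope quotient_scope.
Local Open Scope group_scope.

(* In a word, inl g is the letter g of G, inr (i, false) is x_i and
   inr (i, true) is x_i^-1.  Words need not be reduced. *)
Definition word (G : groupType) (n : nat) := seq (G + 'I_n * bool).

Definition letter_inv (G : groupType) n (l : G + 'I_n * bool) :
    G + 'I_n * bool :=
  match l with inl g => inl g^-1 | inr (i, b) => inr (i, ~~ b) end.

Definition word_inv (G : groupType) n (w : word G n) : word G n :=
  rev (map (@letter_inv G n) w).

(* Two words are equivalent when they represent the same element of the free
   product G * F(x_1, ..., x_n). *)
Inductive word_equiv (G : groupType) (n : nat) : word G n -> word G n -> Prop :=
| word_equiv_refl w : word_equiv w w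
| word_equiv_sym w1 w2 : word_equiv w1 w2 -> word_equiv w2 w1
| word_equiv_trans w1 w2 w3 :
    word_equiv w1 w2 -> word_equiv w2 w3 -> word_equiv w1 w3
| word_equiv_one (s t : word G n) : word_equiv (s ++ inl 1 :: t) (s ++ t)
| word_equiv_mul (s t : word G n) (g h : G) :
    word_equiv (s ++ inl g :: inl h :: t) (s ++ inl (g * h) :: t)
| word_equiv_cancel (s t : word G n) (i : 'I_n) (b : bool) :
    word_equiv (s ++ inr (i, b) :: inr (i, ~~ b) :: t) (s ++ t).

Definition word_eqb (G : groupType) n : rel (word G n) :=
  fun w1 w2 => `[< word_equiv w1 w2 >].

Lemma word_eqb_equiv (G : groupType) n : equiv_class_of (@word_eqb G n).
Proof.
split=> [w|w1 w2|w2 w1 w3].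
- by apply/asboolP; exact: word_equiv_refl.
- by apply/idP/idP => /asboolP h; apply/asboolP; exact: word_equiv_sym.
- move=> /asboolP h1 /asboolP h2; apply/asboolP; exact: word_equiv_trans h1 h2.
Qed.

Canonical word_eqb_equiv_rel (G : groupType) n :=
  EquivRelPack (@word_eqb_equiv G n).

(* The free product G * F(x_1, ..., x_n). *)
Definition free_product (G : groupType) (n : nat) : Type :=
  {eq_quot (@word_eqb G n)}.

HB.instance Definition _ (G : groupType) n := Choice.on (free_product G n).

(* The element of the free product represented by a word. *)
Definition fp_of_word (G : groupType) n (w : word G n) : free_product G n :=
  \pi_({eq_quot (@word_eqb G n)}) w.

Definition word_of_fp (G : groupType) n (u : free_product G n) : word G n :=
  repr (u : {eq_quot (@word_eqb G n)}).

Lemma word_of_fpK (G : groupType) n : cancel (@word_of_fp G n) (@fp_of_word G n).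
Proof. by move=> u; exact: reprK. Qed.

Lemma fp_of_wordP (G : groupType) n (w1 w2 : word G n) :
  fp_of_word w1 = fp_of_word w2 <-> word_equiv w1 w2.
Proof.
split=> [/eqmodP h | h].
- by apply/asboolP; exact: h.
- by apply/eqmodP; apply/asboolP.
Qed.

Section FreeProductGroup.
Variables (G : groupType) (n : nat).
Implicit Types (w s t : word G n) (u v : free_product G n).

Lemma word_equiv_ctx s t w1 w2 :
  word_equiv w1 w2 -> word_equiv (s ++ w1 ++ t) (s ++ w2 ++ t).
Proof.
elim=> {w1 w2} [w|w1 w2 _|w1 w2 w3 _ h1 _ h2|s' t'|s' t' g h|s' t' i b].
- exact: word_equiv_refl.
- exact: word_equiv_sym.
- exact: word_equiv_trans h1 h2.
- by rewrite -!catA !cat_cons (catA s) (catA s s'); exact: word_equiv_one.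
- by rewrite -!catA !cat_cons (catA s) (catA s s'); exact: word_equiv_mul.
- by rewrite -!catA !cat_cons (catA s) (catA s s'); exact: word_equiv_cancel.
Qed.

Lemma word_equiv_cat s s' t t' :
  word_equiv s s' -> word_equiv t t' -> word_equiv (s ++ t) (s' ++ t').
Proof.
move=> hs ht; apply: (@word_equiv_trans _ _ _ (s' ++ t)).
- exact: (word_equiv_ctx [::] t hs).
- by have := word_equiv_ctx s' [::] ht; rewrite !cats0.
Qed.

Lemma word_inv_cat s t : word_inv (s ++ t) = word_inv t ++ word_inv s.
Proof. by rewrite /word_inv map_cat rev_cat. Qed.

Lemma letter_invK : involutive (@letter_inv G n).
Proof. by case=> [g|[i b]] /=; rewrite ?invgK ?negbK. Qed.

Lemma word_invK : involutive (@word_inv G n).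
Proof.
by move=> w; rewrite /word_inv map_rev revK -map_comp (eq_map letter_invK) map_id.
Qed.

Lemma word_invr w : word_equiv (w ++ word_inv w) [::].
Proof.
elim: w => [|l w IHw]; first exact: word_equiv_refl.
rewrite -cat1s word_inv_cat.
apply: (word_equiv_trans (w2 := [:: l] ++ [::] ++ word_inv [:: l])).
  by rewrite -catA (catA w); exact: word_equiv_ctx.
case: l => [g|[i b]].
- apply: word_equiv_trans (word_equiv_mul [::] [::] g g^-1) _.
  by rewrite mulgV; exact: (word_equiv_one [::] [::]).
- exact: (word_equiv_cancel [::] [::] i b).
Qed.

Lemma word_invl w : word_equiv (word_inv w ++ w) [::].
Proof. by rewrite -{2}[w]word_invK; exact: word_invr. Qed.

Lemma word_equiv_inv w1 w2 :
  word_equiv w1 w2 -> word_equiv (word_inv w1) (word_inv w2).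
Proof.
move=> h; apply: (@word_equiv_trans _ _ _ (word_inv w1 ++ (w2 ++ word_inv w2))).
  have := word_equiv_cat (word_equiv_refl (word_inv w1)) (word_invr w2).
  by rewrite cats0 => /word_equiv_sym.
rewrite catA; apply: (@word_equiv_cat _ [::] _ _ _ (word_equiv_refl _)).
apply: word_equiv_trans (word_invl w1).
exact/word_equiv_cat/word_equiv_sym/h/word_equiv_refl.
Qed.

Definition fp_mul u v : free_product G n :=
  fp_of_word (word_of_fp u ++ word_of_fp v).
Definition fp_one : free_product G n := fp_of_word [::].
Definition fp_inv u : free_product G n := fp_of_word (word_inv (word_of_fp u)).

Lemma word_of_fp_equiv w : word_equiv (word_of_fp (fp_of_word w)) w.
Proof. by apply/fp_of_wordP; rewrite word_of_fpK. Qed.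

Lemma fp_mul_word s t :
  fp_mul (fp_of_word s) (fp_of_word t) = fp_of_word (s ++ t).
Proof. by apply/fp_of_wordP/word_equiv_cat; exact: word_of_fp_equiv. Qed.

Lemma fp_inv_word w : fp_inv (fp_of_word w) = fp_of_word (word_inv w).
Proof. by apply/fp_of_wordP/word_equiv_inv/word_of_fp_equiv. Qed.

Lemma fp_mulA : associative fp_mul.
Proof.
move=> u v w; rewrite -[u]word_of_fpK -[v]word_of_fpK -[w]word_of_fpK.
by rewrite !fp_mul_word catA.
Qed.

Lemma fp_mul1 : left_id fp_one fp_mul.
Proof. by move=> u; rewrite -[u]word_of_fpK fp_mul_word. Qed.

Lemma fp_mulr1 : right_id fp_one fp_mul.
Proof. by move=> u; rewrite -[u]word_of_fpK fp_mul_word cats0. Qed.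

Lemma fp_mulV : left_inverse fp_one fp_inv fp_mul.
Proof.
move=> u; rewrite -[u]word_of_fpK fp_inv_word fp_mul_word.
exact/fp_of_wordP/word_invl.
Qed.

Lemma fp_mulrV : right_inverse fp_one fp_inv fp_mul.
Proof.
move=> u; rewrite -[u]word_of_fpK fp_inv_word fp_mul_word.
exact/fp_of_wordP/word_invr.
Qed.

End FreeProductGroup.

HB.instance Definition _ (G : groupType) n :=
  isGroup.Build (free_product G n)
    (@fp_mulA G n) (@fp_mul1 G n) (@fp_mulr1 G n) (@fp_mulV G n) (@fp_mulrV G n).

Section Evaluation.
Variables (G : groupType) (n : nat).
Implicit Types (w : word G n) (u v : free_product G n).

Definition letter_eval (g : n.-tuple G) (l : G + 'I_n * bool) : G :=
  match l with
  | inl a => a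
  | inr (i, b) => if b then (tnth g i)^-1 else tnth g i
  end.

Definition word_eval (g : n.-tuple G) w : G := \prod_(l <- w) letter_eval g l.

(* u(g_1, ..., g_n): the image of u under the homomorphism G * F -> G that is
   the identity on G and maps x_i to g_i; it does not depend on the
   representing word by fp_eval_word. *)
Definition fp_eval (g : n.-tuple G) u : G := word_eval g (word_of_fp u).

Lemma word_eval_equiv (g : n.-tuple G) w1 w2 :
  word_equiv w1 w2 -> word_eval g w1 = word_eval g w2.
Proof.
rewrite /word_eval.
elim=> {w1 w2} [//|//|w1 w2 w3 _ -> _ -> //|s t|s t a b|s t i b];
  rewrite !big_cat /= !big_cons /=; first by rewrite mul1g.
  by rewrite (mulgA a).
by case: b; rewrite /= ?mulKg ?mulVKg.
Qed.

Lemma fp_eval_word (g : n.-tuple G) w : fp_eval g (fp_of_word w) = word_eval g w.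
Proof. exact/word_eval_equiv/word_of_fp_equiv. Qed.

Lemma fp_evalM (g : n.-tuple G) : {morph fp_eval g : u v / u * v}.
Proof.
move=> u v; rewrite -[u]word_of_fpK -[v]word_of_fpK [_ * _]fp_mul_word.
by rewrite !fp_eval_word /word_eval big_cat.
Qed.

Definition letter_exp (i : 'I_n) (l : G + 'I_n * bool) : int :=
  match l with
  | inl _ => 0%R
  | inr (k, b) => if k == i then (if b then (-1)%R else 1%R) else 0%R
  end.

Definition word_expsum (i : 'I_n) w : int := (\sum_(l <- w) letter_exp i l)%R.

(* The exponent sum of x_i in u; see fp_expsum_word. *)
Definition fp_expsum (i : 'I_n) u : int := word_expsum i (word_of_fp u).

Lemma word_expsum_equiv (i : 'I_n) w1 w2 :
  word_equiv w1 w2 -> word_expsum i w1 = word_expsum i w2.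
Proof.
rewrite /word_expsum.
elim=> {w1 w2} [//|//|w1 w2 w3 _ -> _ -> //|s t|s t a b|s t k b];
  rewrite !big_cat /= !big_cons /= ?GRing.add0r //.
case: eqP => _; rewrite ?GRing.add0r //.
by case: b; rewrite /= ?GRing.addKr ?GRing.addNKr.
Qed.

Lemma fp_expsum_word (i : 'I_n) w :
  fp_expsum i (fp_of_word w) = word_expsum i w.
Proof. exact/word_expsum_equiv/word_of_fp_equiv. Qed.

End Evaluation.

Local Open Scope classical_set_scope.

(* The set of solutions of the system {u_j = 1}_(j in J) in G^n. *)
Definition solutions (G : groupType) n (J : Type) (u : J -> free_product G n) :
    set (n.-tuple G) :=
  [set g | forall j, fp_eval g (u j) = 1].

(* Occurrences are read off the words w j that present the elements u_j of the
   free product; the reduced form is one possible choice. *)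
Definition coefficients (G : groupType) n (J : Type) (w : J -> word G n) :
    set G :=
  [set a | exists j, inl a \in w j].

Definition centraliser (G : groupType) (A : set G) : set G :=
  [set c | forall a, A a -> commute c a].

(* The rank of an integer matrix with n columns and an arbitrary, possibly
   infinite, set J of rows: the maximal number of rows linearly independent
   over the rationals. *)
Definition int_rank (J : Type) (n : nat) (M : J -> 'I_n -> int) : nat :=
  \max_(k < n.+1 | `[< exists s : 'I_k -> J,
      row_free (\matrix_(a < k, i < n) ((M (s a) i)%:~R : rat)%R) >]) k.

(* |A| divides |B| as cardinals: |B| = |A| * |D| for some cardinal |D|. *)
Definition card_dvd (T U : Type) (A : set T) (B : set U) : Prop :=
  exists (V : Type) (D : set V), (B #= A `*` D)%card.

(* Main.v *)
(* Since the rank is less than n, the integer matrix has a primitive kernel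
   vector d.  The grading deg x_i = d_i puts every u_j in degree 0, and some
   coefficient-free word t has degree 1.  Let H be the centraliser of the
   coefficients, and restrict each tuple, seen as an evaluation homomorphism, to
   the words of degree 0; being a solution depends only on this restriction.  H
   acts on restrictions by conjugation, and the stabiliser of the restriction of
   g is the centraliser C of its image.  On the other hand the tuples with the
   same restriction as g form a torsor under C: the value T of t may be replaced
   by T c for any c in C, and by nothing else.  So over each H-orbit of
   restrictions there are |H : C| |C| = |H| tuples; choosing coset
   representatives makes this a bijection, valid for all cardinals. *)
Require Import Defs.
From HB Require Import structures.
From mathcomp Require Import all_boot all_order all_algebra.
From mathcomp Require Import boolp classical_sets functions cardinality.

Set Implicit Arguments.
Unset Strict Implicit.
Unset Printing Implicit Defensive.

Import GRing.Theory.

(** * A primitive integer vector in the kernel of the exponent matrix *)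

Section RationalMatrix.
Local Open Scope ring_scope.

Definition rat_rows (J : Type) (n k : nat) (M : J -> 'I_n -> int)
    (s : 'I_k -> J) : 'M[rat]_(k, n) :=
  \matrix_(a < k, i < n) (M (s a) i)%:~R.

Lemma int_rank_exists (J : Type) (n : nat) (M : J -> 'I_n -> int) :
  exists s : 'I_(int_rank M) -> J, row_free (rat_rows M s).
Proof.
pose P (k : 'I_n.+1) := `[< exists s : 'I_k -> J, row_free (rat_rows M s) >].
(* The empty family is free, so the maximum is over a nonempty range and is attained. *)
have P0 : P ord0.
  apply/asboolP; have s0 : 'I_(@ord0 n) -> J by case=> [[]].
  by exists s0; rewrite /row_free eqn_leq rank_leq_row.
have P_gt0 : (0 < #|P|)%N by apply/card_gt0P; exists ord0.
have [k Pk def_k] := eq_bigmax_cond (@nat_of_ord n.+1) P_gt0.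
rewrite [int_rank M]def_k; exact/(asboolP _ Pk).
Qed.

Lemma leq_int_rank (J : Type) (n k : nat) (M : J -> 'I_n -> int)
    (s : 'I_k -> J) : row_free (rat_rows M s) -> (k <= int_rank M)%N.
Proof.
move=> free_s; have lt_kn : (k < n.+1)%N.
  by rewrite ltnS -(eqP free_s) rank_leq_col.
apply: (@leq_bigmax_cond _ _ (@nat_of_ord n.+1) (Ordinal lt_kn)).
by apply/asboolP; exists s.
Qed.

(** Otherwise adjoining row [j] would give a free family longer than the rank. *)
Lemma row_sub_rat_rows (J : Type) (n : nat) (M : J -> 'I_n -> int)
    (s : 'I_(int_rank M) -> J) (j : J) : row_free (rat_rows M s) ->
  ((\row_i (M j i)%:~R : 'rV[rat]_n) <= rat_rows M s)%MS.
Proof.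
move=> free_s; apply/negPn/negP=> notin.
pose s' (a : 'I_(int_rank M + 1)) :=
  if fintype.split a is inl b then s b else j.
have def_s' : rat_rows M s' = col_mx (rat_rows M s) (\row_i (M j i)%:~R).
  apply/matrixP=> a i; rewrite !mxE /s'.
  by case: splitP => b _; rewrite !mxE.
suff /leq_int_rank : row_free (rat_rows M s') by rewrite addn1 ltnn.
rewrite def_s' /row_free eqn_leq rank_leq_row -addsmxE.
rewrite addn1 -{1}(eqP free_s) (ltn_leqif (mxrank_leqif_sup (addsmxSl _ _))).
by rewrite addsmx_sub submx_refl.
Qed.

(** In a Smith form [L D R] of a maximal free family of rows, [d] is a column of the inverse of [R]
    and [e] the matching row of [R], so they pair to 1. All other rows are rational combinations of
    the family, hence vanish on [d] too. *)
Lemma int_rank_lt_kernel (J : Type) (n : nat) (M : J -> 'I_n -> int) :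
    (int_rank M < n)%N ->
  exists d e : 'I_n -> int,
    \sum_i e i * d i = 1 /\ forall j, \sum_i M j i * d i = 0.
Proof.
move=> lt_rn; have [s free_s] := int_rank_exists M.
pose B : 'M[int]_(int_rank M, n) := \matrix_(a, i) M (s a) i.
have [L _ [R uR [D _ defB]]] := int_Smith_normal_form B.
(* D has only int_rank M rows, so its column k vanishes. *)
pose k := Ordinal lt_rn; pose d := col k (invmx R).
have Bd : B *m d = 0.
  rewrite defB /d colE mulmxA mulmxK // -mulmxA -colE.
  rewrite (_ : col k _ = 0) ?mulmx0 //; apply/matrixP=> a b.
  by rewrite !mxE /= (ltn_eqF (ltn_ord a)) mulr0n.
exists (fun i => d i 0), (R k); split=> [|j].
  have <- : (R *m invmx R) k k = 1 by rewrite mulmxV // mxE eqxx.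
  by rewrite mxE; apply: eq_bigr => i _; rewrite [d i 0]mxE.
have /submxP[c defr] := row_sub_rat_rows j free_s.
apply: (@intr_inj rat); rewrite rmorph_sum rmorph0 /=.
have /matrixP/(_ 0 0) : (\row_i (M j i)%:~R : 'rV[rat]_n) *m map_mx intr d = 0.
  rewrite defr (_ : rat_rows M s = map_mx intr B); last first.
    by apply/matrixP=> a i; rewrite !mxE.
  by rewrite -mulmxA -map_mxM Bd map_mx0 mulmx0.
move=> Md0; rewrite 2!mxE in Md0; rewrite -[RHS]Md0.
apply: eq_bigr => i _.
by rewrite rmorphM 2![in RHS]mxE.
Qed.

End RationalMatrix.

Local Open Scope group_scope.
Local Open Scope classical_set_scope.

(** * Integer powers in a group *)

Section IntegerPowers.
Variable G : groupType.
Implicit Types (x : G) (k : int).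

Definition expgz x k : G :=
  match k with Posz m => x ^+ m | Negz m => x ^- m.+1 end.

Lemma expgzS x k : expgz x (k + 1)%R = expgz x k * x.
Proof.
case: k => [m|[|m]]; rewrite ?NegzE.
- by rewrite addrC -intS /= expgSr.
- by rewrite addNr /= expg1 mulVg.
- by rewrite intS opprD addrAC addNr add0r -NegzE /= [in RHS]expgS invgM mulgVK.
Qed.

Lemma expgzB1 x k : expgz x (k - 1)%R = expgz x k * x^-1.
Proof. by rewrite -{2}(subrK 1%R k) expgzS mulgK. Qed.

Lemma expgzD x k l : expgz x (k + l)%R = expgz x k * expgz x l.
Proof.
elim/int_rect: l => [|m IHm|m IHm]; first by rewrite addr0 mulg1.
- by rewrite -addn1 PoszD addrA !expgzS IHm mulgA.
- by rewrite -addn1 PoszD opprD addrA !expgzB1 IHm mulgA.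
Qed.

Lemma expgz1 x : expgz x 1%R = x.
Proof. by rewrite /= expg1. Qed.

Lemma expgzN1 x : expgz x (- 1)%R = x^-1.
Proof. by rewrite /= expg1. Qed.

Lemma expgzN x k : expgz x (- k)%R = (expgz x k)^-1.
Proof. by apply/esym/mulg1_eq; rewrite -expgzD addrN. Qed.

End IntegerPowers.

(** * Powers of words and their constants *)

Section WordPowers.
Variables (G : groupType) (n : nat).
Implicit Types (w : word G n) (g : n.-tuple G) (k : int).

Lemma word_eval_cat g w1 w2 :
  word_eval g (w1 ++ w2) = word_eval g w1 * word_eval g w2.
Proof. by rewrite /word_eval big_cat. Qed.

Lemma word_eval_inv g w : word_eval g (word_inv w) = (word_eval g w)^-1.
Proof.
apply/esym/mulg1_eq; rewrite -word_eval_cat.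
by rewrite (word_eval_equiv g (word_invr w)) /word_eval big_nil.
Qed.

Lemma word_expsum_cat i w1 w2 :
  word_expsum i (w1 ++ w2) = (word_expsum i w1 + word_expsum i w2)%R.
Proof. by rewrite /word_expsum big_cat. Qed.

Lemma word_expsum_inv i w : word_expsum i (word_inv w) = (- word_expsum i w)%R.
Proof.
apply/eqP; rewrite -addr_eq0 -word_expsum_cat.
by rewrite (word_expsum_equiv i (word_invl w)) /word_expsum big_nil.
Qed.

Definition word_pow w k : word G n :=
  match k with
  | Posz m => flatten (nseq m w)
  | Negz m => word_inv (flatten (nseq m.+1 w))
  end.

Lemma word_eval_pow g w k :
  word_eval g (word_pow w k) = expgz (word_eval g w) k.
Proof.
have pow m : word_eval g (flatten (nseq m w)) = word_eval g w ^+ m.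
  elim: m => [|m IHm]; first by rewrite /word_eval big_nil.
  by rewrite expgS -IHm -word_eval_cat.
by case: k => m; rewrite /word_pow ?word_eval_inv pow.
Qed.

Lemma word_expsum_pow i w k :
  word_expsum i (word_pow w k) = (k * word_expsum i w)%R.
Proof.
have pow m : word_expsum i (flatten (nseq m w)) = (m%:Z * word_expsum i w)%R.
  elim: m => [|m IHm]; first by rewrite /word_expsum big_nil mul0r.
  by rewrite -add1n PoszD mulrDl mul1r -IHm -word_expsum_cat.
by case: k => m; rewrite /word_pow ?word_expsum_inv pow // NegzE mulNr.
Qed.

Definition word_over (K : set G) w := forall a, inl a \in w -> K a.

Lemma word_over_cat K w1 w2 :
  word_over K w1 -> word_over K w2 -> word_over K (w1 ++ w2).
Proof. by move=> K1 K2 a; rewrite mem_cat => /orP[/K1|/K2]. Qed.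

Lemma word_over_inv K w : (forall a, K a -> K a^-1) ->
  word_over K w -> word_over K (word_inv w).
Proof.
move=> KV Kw a; rewrite mem_rev => /mapP[[b|[i b]] // wb [->]].
by apply/KV/Kw.
Qed.

Lemma word_over_pow K w k : (forall a, K a -> K a^-1) ->
  word_over K w -> word_over K (word_pow w k).
Proof.
move=> KV Kw; have pow m : word_over K (flatten (nseq m w)).
  by elim: m => [|m IHm] //=; apply: word_over_cat.
by case: k => m; rewrite /word_pow; [|apply: word_over_inv].
Qed.

End WordPowers.

Lemma centraliserV (G : groupType) (A : set G) c :
  centraliser A c -> centraliser A c^-1.
Proof. by move=> Ac a /Ac /commute_sym/commuteV/commute_sym. Qed.

Lemma centraliserM (G : groupType) (A : set G) b c :
  centraliser A b -> centraliser A c -> centraliser A (b * c).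
Proof.
by move=> Ab Ac a Aa; apply/commute_sym/commuteM; apply/commute_sym; auto.
Qed.

(** * The grading and the words of degree 0 *)

Section DegreeZeroWords.
Variables (G : groupType) (n : nat) (A : set G) (d : 'I_n -> int).
Implicit Types (w : word G n) (g : n.-tuple G).

Let H := centraliser A.
(* Unlike A, the bicentraliser is closed under inversion. *)
Let K := centraliser H.

Let K_inv a : K a -> K a^-1.
Proof. exact: centraliserV. Qed.

Definition word_deg w : int := (\sum_i word_expsum i w * d i)%R.

Lemma word_deg_cat w1 w2 : word_deg (w1 ++ w2) = (word_deg w1 + word_deg w2)%R.
Proof.
by rewrite -big_split; apply: eq_bigr => i _; rewrite word_expsum_cat mulrDl.
Qed.

Lemma word_deg_pow w k : word_deg (word_pow w k) = (k * word_deg w)%R.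
Proof.
by rewrite mulr_sumr; apply: eq_bigr => i _; rewrite word_expsum_pow mulrA.
Qed.

Lemma word_deg_inv w : word_deg (word_inv w) = (- word_deg w)%R.
Proof.
by rewrite -sumrN; apply: eq_bigr => i _; rewrite word_expsum_inv mulNr.
Qed.

Lemma word_deg_nil : word_deg [::] = 0%R.
Proof. by apply: big1 => i _; rewrite /word_expsum big_nil mul0r. Qed.

Lemma word_deg_const a : word_deg [:: inl a] = 0%R.
Proof. by apply: big1 => i _; rewrite /word_expsum big_seq1 mul0r. Qed.

Lemma word_deg_var i : word_deg [:: inr (i, false)] = d i.
Proof.
rewrite /word_deg (bigD1 i) //= big1 => [|j /negPf ji].
  by rewrite addr0 /word_expsum big_seq1 /= eqxx mul1r.
by rewrite /word_expsum big_seq1 /= eq_sym ji mul0r.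
Qed.

(** The product of the powers [x_i ^ e_i] works; it has no constants, so it is a word over any
    [L]. *)
Lemma word_deg_surj (e : 'I_n -> int) : (\sum_i e i * d i)%R = 1%R ->
  exists2 t, forall L : set G, word_over L t & word_deg t = 1%R.
Proof.
move=> <-; elim/big_ind: _ => [|k l [t Lt <-] [s Ls <-]|i _].
- by exists [::]; [|exact: word_deg_nil].
- by exists (t ++ s); [move=> L; apply: word_over_cat|exact: word_deg_cat].
exists (word_pow [:: inr (i, false)] (e i)) => [L|].
  suff : word_over (set0 : set G) (word_pow [:: inr (i, false)] (e i)).
    by move=> L0 a /L0.
  by apply: (@word_over_pow _ _ set0) => // a; rewrite inE.
by rewrite word_deg_pow word_deg_var.
Qed.

(** Constants are kept in [K] so that conjugation by [H] fixes them. *)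
Definition deg0_words : set (word G n) :=
  [set w | word_over K w /\ word_deg w = 0%R].

Definition tuple_conj g h : n.-tuple G := [tuple tnth g i ^ h | i < n].

Lemma word_eval_conj g h w : H h -> word_over K w ->
  word_eval (tuple_conj g h) w = word_eval g w ^ h.
Proof.
move=> Hh Kw; rewrite /word_eval conjg_prod; apply: eq_big_seq.
move=> [a /Kw Ka|[i b] _] /=; last first.
  by rewrite tnth_mktuple; case: b; rewrite ?conjVg.
by apply/esym/conjg_fixP/commgP/Ka.
Qed.

Lemma tuple_conjK g h : tuple_conj (tuple_conj g h) h^-1 = g.
Proof. by apply: eq_from_tnth => i; rewrite !tnth_mktuple conjgK. Qed.

Lemma tuple_conjVK g h : tuple_conj (tuple_conj g h^-1) h = g.
Proof. by apply: eq_from_tnth => i; rewrite !tnth_mktuple conjgKV. Qed.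

Definition deg0_centraliser g : set G :=
  centraliser (word_eval g @` deg0_words).

Lemma deg0_centraliserP g c : deg0_centraliser g c <->
  forall w, deg0_words w -> commute c (word_eval g w).
Proof.
split=> [Cc w Nw|Cc _ [w Nw <-]]; last exact: Cc.
by apply: Cc; exists w.
Qed.

(** Each element of [A] is itself a one-letter word of degree 0. *)
Lemma deg0_centraliser_sub g : deg0_centraliser g `<=` H.
Proof.
move=> c /deg0_centraliserP Cc a Aa.
have := Cc [:: inl a]; rewrite /word_eval big_seq1; apply; split.
  by move=> b; rewrite inE => /eqP[->] h Hh; apply/commute_sym/Hh.
exact: word_deg_const.
Qed.

(** * Tuples with a common restriction to degree 0 *)

Variables (t : word G n) (Kt : word_over K t) (deg_t : word_deg t = 1%R).

Lemma deg0_words_conj w : deg0_words w -> deg0_words (t ++ w ++ word_inv t).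
Proof.
move=> [Kw w0]; split.
  by do 2?apply: word_over_cat => //; apply: word_over_inv.
by rewrite !word_deg_cat word_deg_inv w0 add0r addrN.
Qed.

Lemma deg0_words_conjV w : deg0_words w -> deg0_words (word_inv t ++ w ++ t).
Proof.
move=> [Kw w0]; split.
  by do 2?apply: word_over_cat => //; apply: word_over_inv.
by rewrite !word_deg_cat word_deg_inv w0 add0r addNr.
Qed.

Lemma deg0_words_shift w : word_over K w ->
  deg0_words (w ++ word_pow t (- word_deg w)%R).
Proof.
move=> Kw; split; first by apply: word_over_cat => //; apply: word_over_pow.
by rewrite word_deg_cat word_deg_pow deg_t mulr1 addrN.
Qed.

(** Conjugation by [t], in either direction, preserves degree 0, so the value of [t] normalises
    C. *)
Lemma deg0_centraliser_conj g c : deg0_centraliser g c ->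
  deg0_centraliser g (c ^ word_eval g t) /\
  deg0_centraliser g (c ^ (word_eval g t)^-1).
Proof.
move=> /deg0_centraliserP Cc.
split; apply/deg0_centraliserP => w Nw; set x := word_eval g w.
- have := Cc _ (deg0_words_conj Nw); rewrite !word_eval_cat word_eval_inv -/x.
  set T := word_eval g t => cTx; rewrite -[x](conjgKV T) /commute -!conjMg.
  by congr (_ ^ _); rewrite conjgE invgK.
- have := Cc _ (deg0_words_conjV Nw); rewrite !word_eval_cat word_eval_inv -/x.
  set T := word_eval g t => cTx; rewrite -[x](conjgK T) /commute -!conjMg.
  by congr (_ ^ _).
Qed.

(* The coordinates of the homomorphism that agrees with g in degree 0 and
   multiplies the value of t by c on the right. *)
Definition twist g c : n.-tuple G :=
  let T := word_eval g t in
  [tuple tnth g i * (expgz T (- d i)%R * expgz (T * c) (d i)) | i < n].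

Section Twist.
Variables (g : n.-tuple G) (c : G).
Hypothesis Cc : deg0_centraliser g c.

Let T := word_eval g t.
(** The right factor turning [T ^ k] into [(T c) ^ k], to be applied to values of words of degree
    [k]. *)
Let delta (k : int) : G := expgz T (- k)%R * expgz (T * c) k.

Let delta0 : delta 0%R = 1.
Proof. by rewrite /delta oppr0 mulg1. Qed.

Let delta_centralises k : deg0_centraliser g (delta k).
Proof.
(* Since [T] normalises C, this recurrence, read forwards and backwards from 0, keeps [delta] in
   C. *)
have deltaS l : delta (l + 1)%R = (delta l) ^ T * c.
  rewrite /delta opprD addrC expgzD expgzN1 expgzS.
  by rewrite conjgE !mulgA.
elim/int_rect: k => [|m IHm|m IHm].
- by rewrite delta0 => a _; apply/commute_sym/commute1.
- rewrite -addn1 PoszD deltaS; apply: centraliserM => //.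
  by case: (deg0_centraliser_conj IHm).
rewrite -addn1 PoszD opprD.
have -> : delta (- m%:Z - 1)%R = (delta (- m%:Z) * c^-1) ^ T^-1.
  by rewrite -{2}[(- m%:Z)%R](subrK 1%R) deltaS mulgK conjgK.
have [_] := deg0_centraliser_conj (centraliserM IHm (centraliserV Cc)).
exact.
Qed.

(* Words of degree k act on C by conjugation as T ^ k, because they differ from
   t ^ k by a word of degree 0; this makes [w |-> w(g) delta (deg w)]
   multiplicative. *)
Let twist_morph w1 w2 : word_over K w2 ->
  word_eval g w1 * delta (word_deg w1) * (word_eval g w2 * delta (word_deg w2))
    = word_eval g (w1 ++ w2) * delta (word_deg (w1 ++ w2)).
Proof.
move=> Kw2; rewrite word_eval_cat word_deg_cat -!mulgA; congr (_ * _).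
have /deg0_centraliserP := delta_centralises (word_deg w1).
move=> /(_ _ (deg0_words_shift Kw2)); rewrite word_eval_cat word_eval_pow -/T.
move=> cD; transitivity (word_eval g w2 * expgz T (- word_deg w2)%R
    * (delta (word_deg w1) * expgz (T * c) (word_deg w2))).
  by rewrite [RHS]mulgA -cD {2}/delta !mulgA.
by rewrite /delta opprD (addrC (- _)%R) !expgzD !mulgA.
Qed.

Lemma word_eval_twist w : word_over K w ->
  word_eval (twist g c) w = word_eval g w * delta (word_deg w).
Proof.
elim: w => [|l w IHw] Klw.
  by rewrite word_deg_nil delta0 mulg1 /word_eval !big_nil.
have Kw : word_over K w by move=> a wa; apply: Klw; rewrite inE wa orbT.
rewrite -cat1s -twist_morph // word_eval_cat IHw //; congr (_ * _).
have Kv (i : 'I_n) b : word_over K [:: inr (i, b)] by move=> a; rewrite inE.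
have twist_var i : tnth (twist g c) i =
    word_eval g [:: inr (i, false)] * delta (word_deg [:: inr (i, false)]).
  by rewrite tnth_mktuple word_deg_var /word_eval big_seq1.
case: l {Klw} => [a|[i []]]; rewrite {1}/word_eval big_seq1 /=.
- by rewrite word_deg_const delta0 mulg1 /word_eval big_seq1.
(* By multiplicativity, the claimed values at [x_i] and [x_i^-1] multiply to the one at a trivial
   word. *)
- rewrite twist_var; apply/mulg1_eq; rewrite twist_morph //.
  have E := @word_equiv_cancel G n [::] [::] i false.
  rewrite /word_deg (word_eval_equiv g E) /word_eval big_nil mul1g.
  rewrite big1 // => j _; rewrite (word_expsum_equiv j E) /word_expsum.
  by rewrite big_nil mul0r.
- exact: twist_var.
Qed.

Lemma twist_deg0 w : deg0_words w -> word_eval (twist g c) w = word_eval g w.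
Proof. by case=> Kw w0; rewrite word_eval_twist // w0 delta0 mulg1. Qed.

Lemma twist_deg1 : word_eval (twist g c) t = T * c.
Proof. by rewrite word_eval_twist // deg_t /delta expgz1 expgzN1 mulVKg. Qed.

End Twist.

(** Comparing values of [t w t^-1] shows that [c = T^-1 T'] centralises degree 0. As [x_i t^(-d_i)]
    has degree 0, the value of [t] then determines every coordinate. *)
Lemma deg0_eq_twist g g' :
    (forall w, deg0_words w -> word_eval g' w = word_eval g w) ->
  exists2 c, deg0_centraliser g c & g' = twist g c.
Proof.
move=> eq_gg'; exists ((word_eval g t)^-1 * word_eval g' t).
  apply/deg0_centraliserP => w Nw; have := eq_gg' _ (deg0_words_conj Nw).
  rewrite !word_eval_cat !word_eval_inv (eq_gg' w Nw).
  set T := word_eval g t; set T' := word_eval g' t; set x := word_eval g w.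
  move=> E; have {}E : T' * x = T * x * T^-1 * T'.
    by rewrite -(mulgA T) -E mulgA mulgVK.
  by rewrite /commute -mulgA E !mulgA mulVg mul1g.
apply: eq_from_tnth => i; rewrite tnth_mktuple mulVKg.
have Kv : word_over K [:: inr (i, false)] by move=> a; rewrite inE.
have := eq_gg' _ (deg0_words_shift Kv).
rewrite word_deg_var !word_eval_cat !word_eval_pow !expgzN.
have var f : word_eval f [:: inr (i, false)] = tnth f i.
  by rewrite /word_eval big_seq1.
by rewrite !var mulgA => <-; rewrite mulgVK.
Qed.

(** * Orbits of restrictions under [H] and their parametrisation *)

Definition deg0_conj g g' := exists2 h, H h &
  forall w, deg0_words w -> word_eval g' w = word_eval g w ^ h.

Lemma deg0_conj_refl g : deg0_conj g g.
Proof.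
exists 1 => [a _|w _]; last by rewrite conjg1.
exact/commute_sym/commute1.
Qed.

Lemma deg0_conj_sym g g' : deg0_conj g g' -> deg0_conj g' g.
Proof.
move=> [h Hh E]; exists h^-1; first exact: centraliserV.
by move=> w /E ->; rewrite conjgK.
Qed.

Lemma deg0_conj_trans g1 g2 g3 :
  deg0_conj g1 g2 -> deg0_conj g2 g3 -> deg0_conj g1 g3.
Proof.
move=> [h Hh E] [k Hk F]; exists (h * k); first exact: centraliserM.
by move=> w Nw; rewrite F // E // conjgM.
Qed.

Definition deg0_repr g : n.-tuple G :=
  xget [tuple 1 | i < n] [set g' | deg0_conj g g'].

Lemma deg0_reprP g : deg0_conj g (deg0_repr g).
Proof.
apply: (@xgetPex _ _ [set g' | deg0_conj g g']); exists g.
exact: deg0_conj_refl.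
Qed.

(** Equivalent tuples have equal classes, and [xget] depends only on the set. *)
Lemma deg0_repr_eq g g' : deg0_conj g g' -> deg0_repr g = deg0_repr g'.
Proof.
move=> gg'; congr xget; apply/seteqP; split=> h /=.
  exact/deg0_conj_trans/deg0_conj_sym.
exact/deg0_conj_trans.
Qed.

Definition coset_repr g h : G := xget 1 [set r | deg0_centraliser g (h * r^-1)].

Lemma coset_reprP g h : deg0_centraliser g (h * (coset_repr g h)^-1).
Proof.
apply: (@xgetPex _ _ [set r | deg0_centraliser g (h * r^-1)]); exists h => /=.
by rewrite mulgV => a _; apply/commute_sym/commute1.
Qed.

Lemma coset_repr_eq g h k :
  deg0_centraliser g (h * k^-1) -> coset_repr g h = coset_repr g k.
Proof.
move=> Chk; congr xget; apply/seteqP; split=> r /= Cr.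
  rewrite -(divgKA h); apply: centraliserM => //.
  by have := centraliserV Chk; rewrite invgM invgK.
by rewrite -(divgKA k); apply: centraliserM.
Qed.

Lemma coset_repr_centraliser g h : H h -> H (coset_repr g h).
Proof.
move=> Hh; have /deg0_centraliser_sub/centraliserV := @coset_reprP g h.
move=> /centraliserM/(_ Hh); by rewrite invgM invgK mulgVK.
Qed.

(** Write [h = c r] with [c] in C and [r] the coset representative: [c] moves [g] within its fibre,
    then [r] moves the restriction along its orbit. *)
Definition class_param (p : G * n.-tuple G) : n.-tuple G :=
  let r := coset_repr p.2 p.1 in tuple_conj (twist p.2 (p.1 * r^-1)) r.

Lemma class_param_deg0 h g w : H h -> deg0_words w ->
  word_eval (class_param (h, g)) w = word_eval g w ^ coset_repr g h.
Proof.
move=> Hh Nw.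
rewrite (word_eval_conj _ (coset_repr_centraliser g Hh) (proj1 Nw)).
by rewrite twist_deg0 //; exact: coset_reprP.
Qed.

Lemma class_param_conj h g : H h -> deg0_conj g (class_param (h, g)).
Proof.
move=> Hh; exists (coset_repr g h); first exact: coset_repr_centraliser.
by move=> w; exact: class_param_deg0.
Qed.

(** The restriction to degree 0 recovers the coset of [h]; the value of [t] then recovers the factor
    in C. *)
Lemma class_param_inj h h' g : H h -> H h' ->
  class_param (h, g) = class_param (h', g) -> h = h'.
Proof.
move=> Hh Hh' E; have eq_r : coset_repr g h = coset_repr g h'.
  apply: coset_repr_eq; set r := coset_repr g h; set r' := coset_repr g h'.
  have -> : h * h'^-1 = (h * r^-1) * (r * r'^-1) * (h' * r'^-1)^-1.
    by rewrite invgM invgK !mulgA !mulgVK.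
  apply/centraliserM; last exact/centraliserV/coset_reprP.
  apply: centraliserM; first exact: coset_reprP.
  apply/deg0_centraliserP => w Nw; apply/commute_sym/commgP/conjg_fixP.
  rewrite conjgM -(class_param_deg0 g Hh Nw) E class_param_deg0 //.
  by rewrite conjgK.
have eq_tw : twist g (h * (coset_repr g h)^-1) =
    twist g (h' * (coset_repr g h')^-1).
  rewrite -[LHS](tuple_conjK _ (coset_repr g h)).
  rewrite -[tuple_conj _ (coset_repr g h)]/(class_param (h, g)).
  by rewrite E eq_r /class_param /= tuple_conjK.
have := congr1 (fun f => word_eval f t) eq_tw.
rewrite !twist_deg1; try exact: coset_reprP.
by move/mulgI; rewrite eq_r => /mulIg.
Qed.

(** Conjugating [g'] back by the coset representative gives the restriction of [g], hence a twist of
    [g]. *)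
Lemma class_param_surj g g' : deg0_conj g g' ->
  exists2 h, H h & class_param (h, g) = g'.
Proof.
move=> [h0 Hh0 E]; set r := coset_repr g h0.
have Hr : H r := coset_repr_centraliser g Hh0.
have [|c Cc def_c] := @deg0_eq_twist g (tuple_conj g' r^-1).
  move=> w Nw; rewrite (word_eval_conj _ (centraliserV Hr) (proj1 Nw)).
  rewrite E // -conjgM.
  apply/conjg_fixP/commgP/commute_sym.
  by have /deg0_centraliserP := @coset_reprP g h0; apply.
have Hcr : H (c * r) := centraliserM (deg0_centraliser_sub Cc) Hr.
exists (c * r) => //.
have eq_r : coset_repr g (c * r) = r.
  apply: coset_repr_eq; rewrite -mulgA; apply: centraliserM => //.
  by have := centraliserV (@coset_reprP g h0); rewrite invgM invgK.
by rewrite /class_param /= eq_r mulgK -def_c tuple_conjVK.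
Qed.

Lemma card_dvd_deg0_closed (S : set (n.-tuple G)) :
  (forall g g', deg0_conj g g' -> S g -> S g') -> card_dvd H S.
Proof.
(* The cofactor counts the chosen class representatives lying in [S]. *)
move=> closedS; exists (n.-tuple G), [set g | S g /\ deg0_repr g = g].
set D := [set g | _]; have -> : S = class_param @` (H `*` D).
  apply/seteqP; split=> [g Sg|_ [[h g] [/= Hh [Sg _]] <-]].
    have [h Hh def_g] := class_param_surj (deg0_conj_sym (deg0_reprP g)).
    exists (h, deg0_repr g) => //; split=> //=; split.
      exact: closedS (deg0_reprP g) Sg.
    by apply/esym/deg0_repr_eq/deg0_reprP.
  exact: closedS (class_param_conj g Hh) Sg.
apply: inj_card_eq => -[h g] [h' g']; rewrite !inE.
move=> [/= Hh [Sg fix_g]] [/= Hh' [Sg' fix_g']] E.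
have eq_g : g = g'.
  rewrite -fix_g -fix_g'; apply: deg0_repr_eq.
  apply: deg0_conj_trans (class_param_conj g Hh) _; rewrite E.
  exact/deg0_conj_sym/class_param_conj.
by rewrite -eq_g in E *; rewrite (class_param_inj Hh Hh' E).
Qed.

End DegreeZeroWords.

Theorem corollary1 (G : groupType) (n : nat) (J : Type)
    (u : J -> free_product G n) (w : J -> word G n)
    (hw : forall j, fp_of_word (w j) = u j)
    (hrank : (int_rank (fun (j : J) (i : 'I_n) => fp_expsum i (u j)) < n)%N) :
  card_dvd (centraliser (coefficients w)) (solutions u).
Proof.
have [d [e [ed1 ud0]]] := int_rank_lt_kernel hrank.
have [t Kt deg_t] := word_deg_surj G ed1.
apply: (card_dvd_deg0_closed (Kt _) deg_t) => g g' [h Hh gg'] Sg j.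
(* Coefficients lie in their bicentraliser and [d] kills row [j], so [u j] takes conjugate values at
   [g] and [g']. *)
have Nw : deg0_words (coefficients w) d (w j).
  split=> [a wa c Hc|]; first by apply/commute_sym/Hc; exists j.
  rewrite -(ud0 j); apply: eq_bigr => i _.
  by rewrite -hw fp_expsum_word.
by have := Sg j; rewrite -hw !fp_eval_word gg' // => ->; exact: conj1g.
Qed.
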